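(* Every locally compact Polish Abelian group $(G,\cdot)$ admits an invariant metric $\varrho \in \operatorname{Metr}_c(G)$ such that $\operatorname{Iso}(G,\varrho)$ consists precisely of all maps of the forms $x \mapsto a x$ and $x \mapsto a x^{-1}$ $(a \in G)$.
   Context: A topological group is Polish if it is separable and completely metrizable. A metric is proper if all closed balls with respect to it are compact. $\operatorname{Metr}_c(G)$ is the set of all proper metrics on $G$ which induce the topology of $G$. $\operatorname{Iso}(G,\varrho)$ is the group of all bijective isometries of $(G,\varrho)$. *)

(* Defs.v *)
From mathcomp Require Import all_boot all_order all_algebra.
From mathcomp Require Import all_classical all_reals all_analysis.

Set Implicit Arguments.
Unset Strict Implicit.
Unset Printing Implicit Defensive.

Import Order.TTheory GRing.Theory Num.Theory.
Local Open Scope classical_set_scope.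
Local Open Scope ring_scope.

(* Metrics are plain functions, not [metricType] structures, because the
   statements below quantify over several metrics on one fixed space. *)

Definition is_metric (R : realType) (T : Type) (d : T -> T -> R) : Prop :=
  [/\ forall x y, 0 <= d x y,
      forall x y, d x y = 0 <-> x = y,
      forall x y, d x y = d y x
    & forall x y z, d x z <= d x y + d y z].

Definition open_ball (R : realType) (T : Type) (d : T -> T -> R) (x : T) (r : R)
  : set T := [set y | d x y < r].

Definition closed_dball (R : realType) (T : Type) (d : T -> T -> R) (x : T)
  (r : R) : set T := [set y | d x y <= r].

Definition induces_topology (R : realType) (T : topologicalType)
  (d : T -> T -> R) : Prop :=
  forall x : T, nbhs x = nbhs_ball_ (open_ball d) x.

Definition cauchy_sequence (R : realType) (T : Type) (d : T -> T -> R)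
  (u : nat -> T) : Prop :=
  forall e : R, 0 < e ->
    exists N : nat, forall m n : nat,
      (N <= m)%N -> (N <= n)%N -> d (u m) (u n) < e.

Definition completely_metrizable (R : realType) (T : topologicalType) : Prop :=
  exists d : T -> T -> R,
    [/\ is_metric d, induces_topology d
      & forall u : nat -> T, cauchy_sequence d u ->
          exists l : T, u @ \oo --> l].

Definition separable (T : topologicalType) : Prop :=
  exists2 D : set T, countable D & dense D.

Definition polish (R : realType) (T : topologicalType) : Prop :=
  separable T /\ completely_metrizable R T.

(* Compactness is taken in the topology of T, which in [Metr_c] is also the
   topology of d. *)
Definition proper_metric (R : realType) (T : topologicalType)
  (d : T -> T -> R) : Prop :=
  forall (x : T) (r : R), compact (closed_dball d x r).

Definition Metr_c (R : realType) (T : topologicalType) : set (T -> T -> R) :=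
  [set d | [/\ is_metric d, induces_topology d & proper_metric d]].
Arguments Metr_c R T _ : clear implicits.

Definition Iso (R : realType) (T : Type) (d : T -> T -> R) : set (T -> T) :=
  [set f | bijective f /\ forall x y, d (f x) (f y) = d x y].

(* Abelian groups are written additively; commutativity makes left and right
   invariance the same condition. *)
Definition invariant_metric (R : realType) (G : zmodType) (d : G -> G -> R)
  : Prop := forall a x y : G, d (a + x) (a + y) = d x y.

(* Main.v *)
(* Metrics are x, y |-> N (x - y) for a norm N, i.e. a symmetric subadditive
   N >= 0 vanishing only at 0. A proper norm N0 inducing the topology comes from
   the Birkhoff-Kakutani chain construction, applied to neighbourhoods V_k
   (k an integer) of 0 with V_k + V_k + V_k inside V_(k+1) which shrink to 0 as
   k -> -oo and exhaust G by relatively compact sets as k -> +oo.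

   Let (d_n) be a dense sequence. If G is not discrete, put M = sqrt N0. The
   triangle inequality of M has enough slack to absorb the perturbation
     N x = M x + 1/8 sum_n w_n (M (x - d_n) + M (x + d_n) - 2 M (d_n)),
   with w_n = 3/4 * 4^-n. Away from 0, M varies to second order with respect to
   M, so the slope of N at z <> 0, lim_(h -> 0) (N (z + h) - N z) / N h, is
   proportional to the total weight of the n with z = d_n or z = - d_n. This
   determines d_n up to sign, and the slope is an invariant of isometries fixing
   0; such an isometry f therefore maps d_n to d_n or - d_n, hence by density
   every x to x or - x. If G is discrete, a norm injective up to sign does the
   same. Recentring f shows that one sign serves for all x. *)

Require Import Defs.
From mathcomp Require Import all_boot all_order all_algebra.
From mathcomp Require Import all_classical all_reals all_analysis.
From mathcomp Require Import lra.

Import Order.TTheory GRing.Theory Num.Theory.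
Import numFieldNormedType.Exports.
Local Open Scope classical_set_scope.
Local Open Scope ring_scope.

Set Implicit Arguments.
Unset Strict Implicit.
Unset Printing Implicit Defensive.

(** * Group norms and the invariant metrics they define *)

Definition group_norm (R : realType) (G : zmodType) (N : G -> R) : Prop :=
  [/\ forall x, 0 <= N x, forall x, N x = 0 <-> x = 0, forall x, N (- x) = N x
    & forall x y, N (x + y) <= N x + N y].

(** Neighbourhoods of 0 suffice; translation gives those of the other points. *)
Definition norm_topology (R : realType) (G : topologicalZmodType)
    (N : G -> R) : Prop :=
  nbhs (0 : G) = filter_from [set e : R | 0 < e] (fun e => [set x | N x < e]).

(** Once [N] is continuous its sublevel sets are closed, so containment in a compact set makes them
    compact. *)
Definition norm_proper (R : realType) (G : topologicalZmodType) (N : G -> R)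
  : Prop := forall r : R, exists2 K, compact K & [set x | N x <= r] `<=` K.

Lemma addl_continuous (G : topologicalZmodType) (a : G) :
  continuous (fun x : G => a + x).
Proof.
move=> x; apply: (@continuous_comp _ _ _ (fun x => (a, x))
  (fun x : G * G => x.1 + x.2)); last exact: add_continuous.
by apply: cvg_pair; [exact: cvg_cst|exact: cvg_id].
Qed.

Lemma subl_continuous (G : topologicalZmodType) (a : G) :
  continuous (fun x : G => a - x).
Proof.
move=> x; apply: (@continuous_comp _ _ _ (fun x => (a, x))
  (fun x : G * G => x.1 - x.2)); last exact: sub_continuous.
by apply: cvg_pair; [exact: cvg_cst|exact: cvg_id].
Qed.

Lemma nbhs_addl (G : topologicalZmodType) (a : G) (A : set G) :
  nbhs a A <-> nbhs 0 [set h | A (a + h)].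
Proof.
split=> [Aa|A0].
  by have := @addl_continuous G a 0 A; rewrite /= addr0; apply.
have := @addl_continuous G (- a) a [set h | A (a + h)].
rewrite addNr => /(_ A0) A1.
suff -> : A = (fun x => - a + x) @^-1` [set h | A (a + h)] by [].
by apply/funext => x /=; rewrite addrA subrr add0r.
Qed.

Lemma norm_le_dist (R : realType) (G : zmodType) (N : G -> R) (x y : G) :
  group_norm N -> `|N x - N y| <= N (x - y).
Proof.
move=> [_ _ NN Ntri]; have h1 := Ntri (x - y) y; have h2 := Ntri (y - x) x.
have e : N (y - x) = N (x - y) by rewrite -NN opprB.
rewrite !subrK e in h1 h2.
by rewrite ler_norml; apply/andP; split; lra.
Qed.

Lemma norm_nbhs (R : realType) (G : topologicalZmodType) (N : G -> R) (a : G) :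
  group_norm N -> norm_topology N ->
  nbhs a = nbhs_ball_ (open_ball (fun x y : G => N (x - y))) a.
Proof.
move=> [_ _ NN _] tN; apply/seteqP; split=> A.
  move=> /nbhs_addl; rewrite tN => -[e /= e0 sub]; exists e => // y /= ay.
  have /sub /= : N (y - a) < e by rewrite -NN opprB.
  by rewrite addrCA subrr addr0.
move=> [e /= e0 sub]; apply/nbhs_addl; rewrite tN; exists e => // h /= he.
by apply: sub; rewrite /open_ball /= opprD addrA subrr add0r NN.
Qed.

Lemma norm_continuous (R : realType) (G : topologicalZmodType) (N : G -> R) :
  group_norm N -> norm_topology N -> continuous N.
Proof.
move=> nN tN x; apply/cvgrPdist_lt => e e0.
suff : nbhs x [set y | `|N x - N y| < e] by [].
rewrite (norm_nbhs x nN tN); exists e => // y /= xye.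
by apply: le_lt_trans xye; apply: norm_le_dist.
Qed.

Lemma norm_invariant (R : realType) (G : zmodType) (N : G -> R) :
  invariant_metric (fun x y : G => N (x - y)).
Proof. by move=> a x y; rewrite opprD addrACA subrr add0r. Qed.

Lemma norm_Metr_c (R : realType) (G : topologicalZmodType) (N : G -> R) :
  group_norm N -> norm_topology N -> norm_proper N ->
  Metr_c R G (fun x y : G => N (x - y)).
Proof.
move=> nN tN pN; have [N0 Neq0 NN Ntri] := nN; split=> [|x|x r].
- split=> [x y|x y|x y|x y z].
  + exact: N0.
  + split=> [/Neq0 /eqP|->]; first by rewrite subr_eq0 => /eqP.
    by apply/Neq0; rewrite subrr.
  + by rewrite -NN opprB.
  + by have := Ntri (x - y) (y - z); rewrite addrA subrK.
- exact: norm_nbhs.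
- have [K cK NK] := pN r.
  apply: (@subclosed_compact _ _ ((fun k => x - k) @` K)).
  + rewrite /closed_dball.
    apply: (@preimage_closed _ _ (fun y => N (x - y)) [set t | t <= r]).
      move=> y _.
      apply: (@continuous_comp _ _ _ (fun y : G => x - y) N).
        exact: subl_continuous.
      exact: norm_continuous.
    exact: closed_le.
  + apply: continuous_compact => //.
    by apply: continuous_subspaceT; exact: subl_continuous.
  + move=> y /= xyr; exists (x - y); first exact: NK.
    by rewrite opprB addrCA subrr addr0.
Qed.

(** * Norms from chains of neighbourhoods *)

(** [a] is the term at which the partial sums first reach [t]. *)
Lemma split_sum (R : realDomainType) (T : Type) (f : T -> R) (s : seq T)
    (t : R) : (forall x, 0 <= f x) -> s <> [::] ->
  0 <= t <= \sum_(x <- s) f x ->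
  exists s1 a s2, [/\ s = s1 ++ a :: s2, \sum_(x <- s1) f x <= t
    & \sum_(x <- s2) f x <= \sum_(x <- s) f x - t].
Proof.
move=> f0; elim: s t => // a s IH t _ /andP[t0].
rewrite big_cons; have [ta tS|at_ tS] := leP t (f a).
  exists [::], a, s; split => //; rewrite ?big_nil//; lra.
have [||s1 [b [s2 [-> h1 h2]]]] := IH (t - f a).
- by move=> s0; move: tS; rewrite s0 big_nil; lra.
- by apply/andP; split; lra.
exists (a :: s1), b, s2; split=> //; rewrite ?big_cons; first lra.
by move: h2; set S := \sum_(x <- s2) _; set S' := \sum_(x <- _ ++ _) _; lra.
Qed.

(* Split the sum at the term where the partial sums of g cross half of their
   total S: the three pieces then have gauge at most S. *)
Lemma gauge_sum (R : realFieldType) (G : zmodType) (g : G -> R) (s : seq G) :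
  (forall x, 0 <= g x) -> g 0 = 0 ->
  (forall t x y z, g x <= t -> g y <= t -> g z <= t -> g (x + y + z) <= 2 * t) ->
  g (\sum_(x <- s) x) <= 2 * \sum_(x <- s) g x.
Proof.
move=> g_ge0 g0 gD; have [n] := ubnP (size s); elim: n s => // n IH s.
rewrite ltnS => sn; have [->|s0] := pselect (s = [::]).
  by rewrite !big_nil g0 mulr0.
have S0 : 0 <= \sum_(x <- s) g x by apply: sumr_ge0.
have [|s1 [a [s2 [es h1 h2]]]] :=
    @split_sum R G g s ((\sum_(x <- s) g x) / 2) g_ge0 s0.
  by apply/andP; split; lra.
move: sn h1 h2; set S := \sum_(x <- s) _ => sn h1 h2.
rewrite /S es in sn h1 h2 *.
move: sn; rewrite size_cat /= addnS => sn.
have i1 := IH s1 (leq_ltn_trans (leq_addr _ _) sn).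
have i2 := IH s2 (leq_ltn_trans (leq_addl _ _) sn).
have s10 : 0 <= \sum_(x <- s1) g x by apply: sumr_ge0.
have s20 : 0 <= \sum_(x <- s2) g x by apply: sumr_ge0.
move: h1 h2; rewrite !big_cat !big_cons /= => h1 h2.
by rewrite addrA; apply: gD; lra.
Qed.

(** [N x] is the infimum of the sums of [g] over finite decompositions of [x]. Concatenation gives
    subadditivity; [gauge_sum] keeps the infimum above [g x / 2]. *)
Lemma gauge_norm (R : realType) (G : zmodType) (g : G -> R) :
  (forall x, 0 <= g x) -> (forall x, g x = 0 <-> x = 0) ->
  (forall x, g (- x) = g x) ->
  (forall t x y z, g x <= t -> g y <= t -> g z <= t -> g (x + y + z) <= 2 * t) ->
  exists2 N : G -> R, group_norm N & forall x, N x <= g x <= 2 * N x.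
Proof.
move=> g_ge0 g_eq0 gN gD.
pose E x := [set v | exists2 s : seq G, \sum_(y <- s) y = x &
                       v = \sum_(y <- s) g y].
have E_lb x : lbound (E x) (g x / 2).
  move=> _ [s <- ->].
  have := gauge_sum s g_ge0 ((g_eq0 0).2 erefl) gD.
  by rewrite ler_pdivrMr// mulrC.
have E_self x : E x (g x) by exists [:: x]; rewrite big_seq1.
have E_le x v : E x v -> inf (E x) <= v.
  by apply: ge_inf; exists (g x / 2); exact: E_lb.
have le_E x b : lbound (E x) b -> b <= inf (E x).
  by apply: lb_le_inf; exists (g x); exact: E_self.
have E_ge x : g x / 2 <= inf (E x) by apply: le_E; exact: E_lb.
exists (fun x => inf (E x)) => [|x]; last first.
  by apply/andP; split; [exact: E_le|have := E_ge x; lra].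
split=> [x|x|x|x y].
- by apply: le_trans (E_ge x); rewrite divr_ge0.
- split=> [Ex0|->].
    by apply/g_eq0/eqP; rewrite eq_le g_ge0 andbT; have := E_ge x; lra.
  apply/eqP; rewrite eq_le; apply/andP; split.
    by apply: le_trans (E_le _ _ (E_self 0)) _; rewrite (g_eq0 0).2.
  by apply: le_trans (E_ge 0); rewrite divr_ge0.
- suff EN z : inf (E (- z)) <= inf (E z).
    by apply/eqP; rewrite eq_le EN -{1}[x]opprK EN.
  apply: le_E => _ [s <- ->]; apply: E_le.
  exists [seq - y | y <- s]; first by rewrite big_map sumrN.
  by rewrite big_map; apply: eq_bigr => y _; rewrite gN.
- rewrite -lerBlDr; apply: (le_E x) => _ [s <- ->].
  rewrite lerBlDr -lerBlDl; apply: le_E => _ [s' <- ->].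
  rewrite lerBlDl; apply: E_le.
  by exists (s ++ s'); rewrite big_cat.
Qed.

Lemma exprz2_unbounded (R : realType) (t : R) : exists k : int, t < 2 ^ k.
Proof.
exists (Num.bound `|t|)%:Z; apply: (le_lt_trans (ler_norm t)).
apply: (lt_le_trans (archi_boundP (normr_ge0 t))).
rewrite -exprnP -natrX ler_nat ltnW//; exact: ltn_expl.
Qed.

Lemma exprz2_small (R : realType) (e : R) : 0 < e ->
  exists k : int, 2 ^ k < e.
Proof.
move=> e0; have [k ke] := exprz2_unbounded e^-1; exists (- k).
rewrite -invr_expz invf_plt// ?posrE//; exact: exprz_gt0.
Qed.

(** The infimum of the [2 ^ k] with [x] in [V k] is a gauge, hence within a factor 2 of a norm,
    whose balls are then comparable with the sets [V k]. *)
Lemma base_norm (R : realType) (G : topologicalZmodType) (V : int -> set G) :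
  (forall k, V k 0) -> (forall k x, V k x -> V k (- x)) ->
  (forall k x y z, V k x -> V k y -> V k z -> V (k + 1) (x + y + z)) ->
  (forall k, nbhs 0 (V k)) -> (forall U, nbhs 0 U -> exists k, V k `<=` U) ->
  (forall x, (forall k, V k x) -> x = 0) ->
  (forall x, exists k, V k x) ->
  (forall k, exists2 K, compact K & V k `<=` K) ->
  exists N : G -> R, [/\ group_norm N, norm_topology N & norm_proper N].
Proof.
move=> V0 VN VD Vnbhs Vbase Vsep Vcover Vcpt.
have Vmono k l x : k <= l -> V k x -> V l x.
  move=> kl Vkx; have -> : l = k + `|l - k|%N.
    by rewrite gez0_abs ?subr_ge0// addrCA subrr addr0.
  elim: `|l - k|%N => [|n IH]; first by rewrite addr0.
  rewrite -addn1 PoszD addrA -[x]addr0 -[x]addr0; exact: VD.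
pose E x := [set v : R | exists2 k : int, V k x & v = 2 ^ k].
have E0 x : lbound (E x) 0 by move=> _ [k _ ->]; exact: exprz_ge0.
have Ene x : E x !=set0 by have [k Vkx] := Vcover x; exists (2 ^ k), k.
pose g x := inf (E x).
have g_ge0 x : 0 <= g x by exact: lb_le_inf.
have g_le k x : V k x -> g x <= 2 ^ k.
  by move=> Vkx; apply: ge_inf; [exists 0; exact: E0|exists k].
have g_lt x t : g x < t -> exists2 k : int, V k x & 2 ^ k < t.
  move=> gxt; have gt0 : 0 < t - g x by rewrite subr_gt0.
  have [|_ [k Vkx ->]] := inf_adherent gt0 (E := E x).
    by split => //; exists 0; exact: E0.
  by rewrite -/(g x) addrC subrK; exists k.
have g_ltV k x : g x < 2 ^ k -> V k x.
  move=> /g_lt[l Vlx lk]; apply: Vmono Vlx.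
  by move: lk; rewrite ltr_eXz2l ?ltr1n// => /ltW.
have g_eq0 x : g x = 0 <-> x = 0.
  split=> [gx0|->]; first by apply: Vsep => k; apply: g_ltV; rewrite gx0 exprz_gt0.
  apply/eqP; rewrite eq_le g_ge0 andbT; apply/ler_addgt0Pr => e e0.
  have [k ke] := exprz2_small e0; rewrite add0r; apply: le_trans (ltW ke).
  exact: g_le.
have gN x : g (- x) = g x.
  suff gN' y : g (- y) <= g y.
    by apply/eqP; rewrite eq_le gN' -{1}[x]opprK gN'.
  apply: lb_le_inf => // _ [k Vky ->]; apply: g_le; exact: VN.
have gD t x y z : g x <= t -> g y <= t -> g z <= t -> g (x + y + z) <= 2 * t.
  move=> xt yt zt; apply/ler_addgt0Pr => e e0.
  (* The infimum need not be attained, whence the margin [e / 2]; the largest of the three indices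
     serves for all, and passing to [m + 1] doubles [2 ^ m]. *)
  have lt_te u : g u <= t -> exists2 k : int, V k u & 2 ^ k < t + e / 2.
    by move=> ut; apply: g_lt; lra.
  have [[i Vi it] [j Vj jt] [k Vk kt]] :=
    And3 (lt_te _ xt) (lt_te _ yt) (lt_te _ zt).
  pose m := Num.max i (Num.max j k).
  have mt : 2 ^ m < t + e / 2 :> R 
    by rewrite /m /Num.max; case: ifP => _ //; case: ifP.
  have Vm : V (m + 1) (x + y + z).
    by apply: VD; [apply: Vmono Vi|apply: Vmono Vj|apply: Vmono Vk];
      rewrite /m !le_max lexx ?orbT.
  apply: le_trans (g_le _ _ Vm) _; rewrite expfzDr ?pnatr_eq0// expr1z; lra.
have [N nN gle] := gauge_norm g_ge0 g_eq0 gN gD; exists N; split=> //.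
- apply/seteqP; split=> U.
    move=> /Vbase[k VU]; exists (2 ^ k / 2) => /=.
      by rewrite divr_gt0// exprz_gt0.
    move=> x /= Nx; apply/VU/g_ltV; have /andP[_] := gle x; lra.
  move=> [e /= e0 NU]; have [k ke] := exprz2_small e0.
  apply: filterS (Vnbhs k) => x Vkx; apply: NU => /=.
  have /andP[le_g _] := gle x; apply: le_lt_trans ke.
  by apply: le_trans le_g _; exact: g_le.
- move=> r; have [k kr] := exprz2_unbounded (2 * r).
  have [K cK VK] := Vcpt k; exists K => // x /= Nxr; apply/VK/g_ltV.
  have /andP[_ g_le2] := gle x; apply: le_lt_trans kr.
  by apply: le_trans g_le2 _; lra.
Qed.

(** * Proper norms on locally compact Polish abelian groups *)

Lemma separable_seq (T : topologicalType) (x0 : T) : separable T ->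
  exists d : nat -> T, forall (x : T) (A : set T), nbhs x A -> exists n, A (d n).
Proof.
move=> [D /countable_injP[f f_inj] denseD].
(* Indices not attained by [f] on [D] yield the default [x0], which does no harm to density. *)
exists (fun n => xget x0 [set x | D x /\ f x = n]) => x A xA.
have [|y [/= Ay Dy]] := denseD A^° _ (@open_interior _ A).
  by exists x.
exists (f y); suff -> : xget x0 [set z | D z /\ f z = f y] = y.
  exact: interior_subset.
apply: xget_unique => // z [Dz fzy]; apply: f_inj; rewrite ?inE//.
Qed.

(** [U] is halved twice and the result made symmetric; the third summand [z] is read as [z + 0]. *)
Lemma nbhs0_triple (G : topologicalZmodType) (U : set G) : nbhs 0 U ->
  exists W : set G, [/\ nbhs 0 W, forall x, W x -> W (- x)
    & forall x y z, W x -> W y -> W z -> U (x + y + z)].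
Proof.
have half (A : set G) : nbhs 0 A ->
    exists2 B : set G, nbhs 0 B & forall x y, B x -> B y -> A (x + y).
  move=> A0; have := @add_continuous G (0, 0) A; rewrite /= addr0.
  move=> /(_ A0)[[B C] /= [B0 C0] BCA]; exists (B `&` C); first exact: filterI.
  by move=> x y [Bx _] [_ Cy]; apply: (BCA (x, y)).
move=> /half[A A0 AU]; have [B B0 BA] := half _ A0.
have NB0 : nbhs 0 [set x : G | B (- x)].
  by have := @opp_continuous G 0 B; rewrite oppr0; apply.
exists (B `&` [set x | B (- x)]); split; first exact: filterI.
  by move=> x /= [Bx BNx]; rewrite opprK.
move=> x y z [Bx _] [By _] [Bz _]; apply: AU; first exact: BA.
by rewrite -[z]addr0; apply: BA => //; exact: nbhs_singleton.
Qed.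

Definition triple_sum (G : zmodType) (A : set G) : set G :=
  [set x | exists a b c, [/\ A a, A b, A c & x = a + b + c]].

Lemma triple_sum_compact (G : topologicalZmodType) (A K : set G) :
  compact K -> A `<=` K -> exists2 L, compact L & triple_sum A `<=` L.
Proof.
move=> cK AK.
exists ((fun p : G * G => p.1 + p.2) @`
  (((fun p : G * G => p.1 + p.2) @` (K `*` K)) `*` K)).
  have cadd (L : set (G * G)) : compact L ->
      compact ((fun p : G * G => p.1 + p.2) @` L).
    apply: continuous_compact; apply: continuous_subspaceT.
    exact: add_continuous.
  by do 2 (apply: (cadd _); apply: compact_setX => //).
move=> _ [a [b [c [Aa Ab Ac ->]]]]; exists (a + b, c) => //; split; last exact: AK.
by exists (a, b) => //; split; exact: AK.
Qed.

(* Struble's theorem for abelian groups. *)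
Lemma proper_norm_exists (R : realType) (G : topologicalZmodType) :
  locally_compact [set: G] -> polish R G ->
  exists N : G -> R, [/\ group_norm N, norm_topology N & norm_proper N].
Proof.
move=> lcG [sepG [d [[d_ge0 d_eq0 _ _] dtop _]]].
have [e e_dense] := @separable_seq G 0 sepG.
have invn_small (r : R) : 0 < r -> exists n, n.+1%:R^-1 < r.
  move=> r0; exists (Num.bound r^-1); rewrite invf_plt ?posrE//.
  apply: lt_le_trans (archi_boundP _) _; first by rewrite invr_ge0 ltW.
  by rewrite ler_nat.
(* Choosing [W] for all sets at once, arbitrarily off the neighbourhoods of 0, makes [U] below a
   plain recursion. *)
have /choice[W WP] : forall U : set G, exists W : set G, nbhs 0 U ->
    [/\ nbhs 0 W, forall x, W x -> W (- x)
      & forall x y z, W x -> W y -> W z -> U (x + y + z)].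
  move=> U; have [/nbhs0_triple[W WU]|nU] := pselect (nbhs 0 U).
    by exists W.
  by exists set0.
have [C C0 [C' C'C [cC' _]]] : exists2 C : set G, nbhs 0 C & precompact C.
  have [|B B0 [cB clB]] := lcG 0; first by [].
  exists B; last by exists B.
  by move: B0; rewrite /within/=; apply: filterS => x; apply.
pose K0 := C `&` [set x | C (- x)].
have K0nbhs : nbhs 0 K0.
  apply: filterI => //.
  by have := @opp_continuous G 0 C; rewrite oppr0; apply.
(* Adjoining [e n] and [- e n] at stage [n] makes the [K n] exhaust [G]: each point differs from
   some [e n] by an element of [K0]. *)
pose aug n (A : set G) := A `|` [set e n; - e n].
pose K := fix K n := if n is m.+1 then triple_sum (aug m (K m)) else K0.
pose b n : set G := [set x | d 0 x < n.+1%:R^-1].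
have b0 n : nbhs 0 (b n).
  by rewrite dtop; exists n.+1%:R^-1 => //=; rewrite invr_gt0.
pose U := fix U n := W (b n `&` (if n is m.+1 then U m else K0)).
(* [Negz n] is [- (n + 1)], so [U 0] is one step below [K0], the set of index 0. *)
pose V k := match k with Posz n => K n | Negz n => U n end.
have U0 n : nbhs 0 (U n).
  elim: n => [|n IH] /=.
    by have [] := WP (b 0%N `&` K0) (filterI (b0 0%N) K0nbhs).
  by have [] := WP (b n.+1 `&` U n) (filterI (b0 n.+1) IH).
have UP n : [/\ nbhs 0 (U n), forall x, U n x -> U n (- x)
      & forall x y z, U n x -> U n y -> U n z ->
        (b n `&` (if n is m.+1 then U m else K0)) (x + y + z)].
  by case: n => [|n] /=; apply: WP; apply: filterI.
have V0 k : V k 0.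
  case: k => n /=; last exact: nbhs_singleton.
  elim: n => [|n IH] /=; first exact: nbhs_singleton.
  by exists 0, 0, 0; rewrite !addr0; split => //; left.
have K_aug n x : aug n (K n) x -> K n.+1 x.
  move=> Kx; exists x, 0, 0; rewrite !addr0; split => //; left; exact: (V0 n%:Z).
have KS n : K n `<=` K n.+1 by move=> x Kx; apply: K_aug; left.
have K0S n : K0 `<=` K n by elim: n => // n IH x /IH /KS.
apply: (@base_norm R G V) => // [k x|k x y z|k|A|x Vx|x|k].
- case: k => n /=; last by have [_ + _] := UP n; apply.
  elim: n x => [|n IH] x /=.
    by move=> [Cx CNx]; split => //=; rewrite opprK.
  have augN y : aug n (K n) y -> aug n (K n) (- y).
    by move=> [/IH|[->|->]]; [left|right; right|right; left; rewrite opprK].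
  move=> [a1 [a2 [a3 [/augN A1 /augN A2 /augN A3 ->]]]].
  by exists (- a1), (- a2), (- a3); rewrite !opprD.
- case: k => n /=.
    by rewrite addn1 => Kx Ky Kz; exists x, y, z; split => //; left.
  have [_ _ UA] := UP n => Ux Uy Uz; have [_] := UA _ _ _ Ux Uy Uz.
  by case: n {UA Ux Uy Uz} => //= n; rewrite subn1.
- case: k => n; last exact: U0.
  exact: filterS (K0S n) K0nbhs.
- rewrite dtop => -[r /= r0 rA].
  have [n nr] := invn_small _ r0.
  exists (Negz n) => x /= Ux; apply: rA; have [_ _ UA] := UP n.
  have [+ _] := UA _ _ _ Ux (nbhs_singleton (U0 n)) (nbhs_singleton (U0 n)).
  by rewrite !addr0 => /lt_trans; apply.
- apply/esym/d_eq0/eqP; rewrite eq_le d_ge0 andbT; apply/ler_addgt0Pr => r r0.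
  have [n nr] := invn_small _ r0.
  have [_ _ UA] := UP n; have := Vx (Negz n) => /= Ux.
  have [+ _] := UA _ _ _ Ux (nbhs_singleton (U0 n)) (nbhs_singleton (U0 n)).
  by rewrite !addr0 add0r => /ltW/le_trans; apply; exact: ltW.
- have : nbhs x [set y | K0 (x - y)].
    by have := @subl_continuous G x x K0; rewrite subrr; apply.
  move=> /e_dense[n /= /(K0S n) Kx]; exists n.+1%:Z => /=.
  exists (x - e n), (e n), 0; rewrite addr0 subrK; split => //.
  + by left.
  + by right; left.
  + by left; exact: (V0 n%:Z).
- have Kcpt n : exists2 L, compact L & K n `<=` L.
    elim: n => [|n [L cL KL]]; first by exists C' => // x [/C'C].
    apply: (@triple_sum_compact _ _ (L `|` ([set e n] `|` [set - e n]))).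
      by apply: compactU => //; apply: compactU; exact: compact_set1.
    by move=> x [/KL|]; [left|right].
  case: k => n; first exact: Kcpt.
  exists C' => // x /= Ux; apply: C'C.
  have UK0 m y : U m y -> K0 y.
    elim: m y => [|m IH] y Uy; [have [_ _ UA] := UP 0%N|have [_ _ UA] := UP m.+1];
      have [_] := UA _ _ _ Uy (nbhs_singleton (U0 _)) (nbhs_singleton (U0 _));
      by rewrite !addr0 // => /IH.
  by have [] := UK0 _ _ Ux.
Qed.

(** * Sums with geometric weights *)

(* The weights add up to 1. *)
Definition wsum (R : realType) (u : nat -> R) : R :=
  limn (series (fun n => geometric (3 / 4) 4^-1 n * u n)).

Section wsum_theory.
Context {R : realType}.
Implicit Types (u v : nat -> R) (C : R).

Lemma wsum_cvg u C : (forall n, `|u n| <= C) ->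
  cvgn (series (fun n => geometric (3 / 4) 4^-1 n * u n)).
Proof.
move=> uC; apply: normed_cvg.
have w0 n : 0 <= geometric (3 / 4) 4^-1 n :> R.
  by rewrite /geometric /= mulr_ge0// exprn_ge0// invr_ge0.
apply: (@series_le_cvg _ _ (geometric (3 / 4 * C) 4^-1)) => [n|n|n|].
- exact: normr_ge0.
- rewrite /geometric /= mulr_ge0// ?exprn_ge0 ?invr_ge0// mulr_ge0//.
  exact: le_trans (uC 0%N).
- rewrite /= normrM ger0_norm// /geometric /= [3 / 4 * C * _]mulrAC.
  by apply: ler_wpM2l; [exact: (w0 n)|exact: uC].
- by apply: is_cvg_geometric_series; rewrite ger0_norm; lra.
Qed.

Lemma wsum_cst C : wsum (fun=> C) = C.
Proof.
apply/cvg_lim => //.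
have -> : (fun n => geometric (3 / 4) 4^-1 n * C) = geometric (3 / 4 * C) 4^-1.
  by apply/funext => n; rewrite /geometric /= [3 / 4 * C * _]mulrAC.
have h : 3 / 4 * C / (1 - 4^-1) = C.
  have -> : 1 - 4^-1 = 3 / 4 :> R by lra.
  by rewrite mulrAC divff ?mul1r//; lra.
by rewrite -[X in _ --> X]h; apply: cvg_geometric_series; rewrite ger0_norm; lra.
Qed.

Lemma wsumB u v C : (forall n, `|u n| <= C) -> (forall n, `|v n| <= C) ->
  wsum (fun n => u n - v n) = wsum u - wsum v.
Proof.
move=> /wsum_cvg cu /wsum_cvg cv; rewrite /wsum -lim_seriesB//.
by congr (limn (series _)); apply/funext => n; rewrite mulrBr.
Qed.

Lemma wsumZ a u C : (forall n, `|u n| <= C) ->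
  wsum (fun n => a * u n) = a * wsum u.
Proof.
move=> /wsum_cvg cu; rewrite /wsum -[RHS]lim_seriesZ//.
by congr (limn (series _)); apply/funext => n; rewrite mulrCA.
Qed.

Lemma wsum_norm u C : (forall n, `|u n| <= C) -> `|wsum u| <= C.
Proof.
move=> uC; have C0 : 0 <= C := le_trans (normr_ge0 _) (uC 0%N).
have cst_cvg c := @wsum_cvg (fun=> c) `|c| (fun=> lexx _).
rewrite ler_norml; apply/andP; split.
  rewrite -[leLHS]wsum_cst; apply: lim_series_le.
  - exact: cst_cvg.
  - exact: wsum_cvg uC.
  - move=> n; apply: ler_wpM2l; last by have := uC n; rewrite ler_norml => /andP[].
    by rewrite /geometric /= mulr_ge0// exprn_ge0// invr_ge0.
rewrite -[leRHS]wsum_cst; apply: lim_series_le.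
- exact: wsum_cvg uC.
- exact: cst_cvg.
- move=> n; apply: ler_wpM2l; last by have := uC n; rewrite ler_norml => /andP[].
  by rewrite /geometric /= mulr_ge0// exprn_ge0// invr_ge0.
Qed.

Lemma wsum_ge0 u C : (forall n, 0 <= u n) -> (forall n, u n <= C) ->
  0 <= wsum u.
Proof.
move=> u0 uC; have uC' n : `|u n| <= C by rewrite ger0_norm.
have C0 : 0 <= C := le_trans (u0 0%N) (uC 0%N).
(* Nonnegativity follows from the norm bound: [C - u] is bounded by [C], hence so is
   [C - wsum u]. *)
have /wsum_norm : forall n, `|C - u n| <= C.
  by move=> n; rewrite ger0_norm ?subr_ge0// gerBl.
rewrite (@wsumB _ _ C)// ?wsum_cst => [|n]; last by rewrite ger0_norm.
by rewrite ler_norml => /andP[]; lra.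
Qed.

(** The weights are geometric, so the tail is a quarter of a sum of the same kind; later inductions
    on the index use this. *)
Lemma wsum_recl u C : (forall n, `|u n| <= C) ->
  wsum u = 3 / 4 * u 0%N + 4^-1 * wsum (u \o S).
Proof.
move=> uC; apply/cvg_lim => //; rewrite -(cvg_shiftS (series _)).
have -> : (fun n => series (fun n => geometric (3 / 4) 4^-1 n * u n) n.+1) =
    (fun n => 3 / 4 * u 0%N +
       4^-1 * series (fun n => geometric (3 / 4) 4^-1 n * (u \o S) n) n).
  apply/funext => n; rewrite /series /= big_nat_recl//= /geometric /= expr0 mulr1.
  by rewrite mulr_sumr; congr (_ + _); apply: eq_bigr => i _; rewrite exprS; lra.
apply: cvgD; first exact: cvg_cst.
by apply: cvgMr; apply: (@wsum_cvg (u \o S) C) => n; exact: uC.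
Qed.

(** Dominated convergence: the first [M] terms converge one by one, and the rest costs at most
    [2 * C * 4^-1 ^+ M]. *)
Lemma wsum_dominated (T : Type) (F : set_system T) (FF : Filter F)
    (u : T -> nat -> R) (l : nat -> R) C :
  (forall h n, `|u h n| <= C) -> (forall n, `|l n| <= C) ->
  (forall n, u h n @[h --> F] --> l n) -> wsum (u h) @[h --> F] --> wsum l.
Proof.
move=> uC lC ul.
(* The sequences are generalised because the induction shifts them; averaging with weights 3/4 and
   1/4 keeps the error [e] and divides the tail by 4. *)
have approx M : forall (v : T -> nat -> R) (m : nat -> R) e, 0 < e ->
    (forall h n, `|v h n| <= C) -> (forall n, `|m n| <= C) ->
    (forall n, v h n @[h --> F] --> m n) ->
    \forall h \near F, `|wsum m - wsum (v h)| <= e + 2 * C * 4^-1 ^+ M.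
  elim: M => [|M IH] v m e e0 vC mC vm.
    near=> h; rewrite expr0 mulr1.
    have := wsum_norm mC; have := wsum_norm (vC h).
    by have := ler_normB (wsum m) (wsum (v h)); lra.
  have IHe := IH (fun h => v h \o S) (m \o S) e e0 (fun h n => vC h n.+1)
    (fun n => mC n.+1) (fun n => vm n.+1).
  have /cvgrPdist_le /(_ e e0) v0 := vm 0%N.
  near=> h; rewrite (wsum_recl mC) (wsum_recl (vC h)).
  have h1 : `|m 0%N - v h 0%N| <= e by near: h.
  have h2 : `|wsum (m \o S) - wsum (v h \o S)| <= e + 2 * C * 4^-1 ^+ M.
    by near: h.
  move: h1 h2; rewrite exprS; set P := 4^-1 ^+ M.
  rewrite !ler_norml => /andP[? ?] /andP[? ?]; apply/andP; split; lra.
apply/cvgrPdist_lt => e e0.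
have C0 : 0 <= C := le_trans (normr_ge0 _) (lC 0%N).
have [M Me] : exists M, 2 * C * 4^-1 ^+ M < e / 2.
  have : (fun M => 2 * C * 4^-1 ^+ M : R) @ \oo --> 2 * C * 0.
    by apply: cvgMr; apply: cvg_expr; rewrite ger0_norm; lra.
  rewrite mulr0 => /cvgrPdist_lt /(_ (e / 2)) [|M _ /(_ M (leqnn M))]; first lra.
  by rewrite sub0r normrN => /ltr_normlW; exists M.
have e2 : 0 < e / 2 by lra.
have := approx M u l (e / 2) e2 uC lC ul.
by apply: filterS => h; lra.
Unshelve. all: by end_near.
Qed.

(* The weights decrease fast enough for digits in [0, 2] to be compared
   lexicographically. *)
Lemma wsum_lt_digits (n : nat) u v :
  (forall i, 0 <= u i <= 2) -> (forall i, 0 <= v i <= 2) ->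
  (forall i, (i <= n)%N -> u i = 0) -> 1 <= v n -> wsum u < wsum v.
Proof.
have digit_norm (w : nat -> R) : (forall i, 0 <= w i <= 2) -> forall i, `|w i| <= 2.
  by move=> w02 i; have /andP[? ?] := w02 i; rewrite ger0_norm.
elim: n u v => [|n IH] u v u02 v02 u0 vn.
all: rewrite (wsum_recl (digit_norm _ u02)) (wsum_recl (digit_norm _ v02)) u0//.
  (* At the decisive digit the left side is at most 1/4 * 2 and the right side at least 3/4. *)
  have := wsum_norm (fun i => digit_norm _ u02 i.+1).
  have : 0 <= wsum (v \o S).
    by apply: (@wsum_ge0 _ 2) => i; have /andP[] := v02 i.+1.
  have := ler_norm (wsum (u \o S)).
  rewrite /comp; lra.
have /andP[v00 _] := v02 0%N.
have : wsum (u \o S) < wsum (v \o S).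
  by apply: IH => // [i|i|i i_n]; [exact: u02|exact: v02|exact: u0].
lra.
Qed.

End wsum_theory.

(** * The square root of a proper norm *)

(* The square root makes the triangle inequality strict, and turns the
   Lipschitz bound on N into one of order 2 away from 0. *)
Section sqrt_norm.
Context {R : realType} {G : topologicalZmodType} (N : G -> R).
Hypotheses (nN : group_norm N) (tN : norm_topology N) (pN : norm_proper N).

Let M x := Num.sqrt (N x).

Let sqrM x : M x * M x = N x.
Proof. by have [N0 _ _ _] := nN; rewrite -expr2 sqr_sqrtr. Qed.

(** After squaring, the cross term [M x * M y] is at least [N y], as [M y <= M x]. The half of [M y]
    saved here pays for the perturbation later. *)
Lemma sqrt_norm_half x y : M y <= M x -> M (x + y) <= M x + M y / 2.
Proof.
move=> yx; have [_ _ _ Ntri] := nN; have := Ntri x y.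
have := sqrtr_ge0 (N x); have := sqrtr_ge0 (N y).
rewrite -/(M x) -/(M y) -!sqrM => y0 x0 xy.
rewrite -ler_sqr ?nnegrE ?sqrtr_ge0//; last lra.
rewrite !expr2; nra.
Qed.

Lemma sqrt_norm_group_norm : group_norm M.
Proof.
have [N0 Neq0 NN Ntri] := nN; split=> [x|x|x|x y].
- exact: sqrtr_ge0.
- split=> [Mx0|->]; first by apply/Neq0; rewrite -sqrM Mx0 mulr0.
  by rewrite /M (Neq0 0).2 ?sqrtr0.
- by rewrite /M NN.
- have := sqrtr_ge0 (N x); have := sqrtr_ge0 (N y); rewrite -/(M x) -/(M y).
  have [yx|/ltW xy] := leP (M y) (M x).
    by have := sqrt_norm_half yx; lra.
  by have := sqrt_norm_half xy; rewrite [y + x]addrC; lra.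
Qed.

Lemma sqrt_norm_topology : norm_topology M.
Proof.
have [N0 _ _ _] := nN.
rewrite /norm_topology tN; apply/seteqP; split=> U [e /= e0 NU].
  exists (Num.sqrt e); first by rewrite /= sqrtr_gt0.
  by move=> x /= Mx; apply: NU => /=; move: Mx; rewrite /M ltr_sqrt.
exists (e * e); first by rewrite /= mulr_gt0.
move=> x /= Nx; apply: NU => /=; rewrite /M -[ltRHS]ger0_norm ?ltW//.
by rewrite -sqrtr_sqr ltr_sqrt ?exprn_gt0// expr2.
Qed.

Lemma sqrt_norm_proper : norm_proper M.
Proof.
move=> r; have [K cK NK] := pN (r * r); exists K => // x /= Mx; apply: NK => /=.
by rewrite -sqrM; apply: ler_pM; rewrite ?sqrtr_ge0.
Qed.

(** At 0 the quotient is 1. At a nonzero [a], the product of [|M (a + h) - M a|] and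
    [M (a + h) + M a] is at most [N h = M h * M h], so the quotient is bounded by [M h / M a]. *)
Lemma sqrt_norm_slope a :
  (M (a + h) - M a) / M h @[h --> (0 : G)^'] --> ((a == 0)%:R : R).
Proof.
have [M0 Meq0 MN Mtri] := sqrt_norm_group_norm.
have Mpos x : x != 0 -> 0 < M x.
  by move=> x0; rewrite lt_neqAle M0 andbT eq_sym; apply: contra_neq x0 => /Meq0.
have [->|a0] := eqVneq a 0.
  apply/cvgrPdist_lt => e e0; near=> h.
  have h0 : h != 0 by near: h; exact: nbhs_dnbhs_neq.
  rewrite add0r (Meq0 0).2// subr0 divff ?subrr ?normr0//.
  by rewrite gt_eqF// Mpos.
have Ma := Mpos _ a0; apply/cvgrPdist_lt => e e0; near=> h.
have h0 : h != 0 by near: h; exact: nbhs_dnbhs_neq.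
have Mh := Mpos _ h0.
have Mhe : M h < e * M a.
  near: h; apply: nbhs_dnbhs; rewrite sqrt_norm_topology.
  by exists (e * M a) => //=; exact: mulr_gt0.
rewrite sub0r normrN normrM [`|(M h)^-1|]gtr0_norm ?invr_gt0// ltr_pdivrMr//.
have NaN := norm_le_dist (a + h) a nN.
rewrite -!sqrM addrAC subrr add0r in NaN.
have := M0 (a + h); move: NaN; set b := M (a + h) => NaN b0.
have /= : `|b - M a| * (b + M a) <= M h * M h.
  apply: le_trans NaN; rewrite -{1}[b + M a]ger0_norm ?addr_ge0// -normrM.
  by rewrite le_eqVlt; apply/orP; left; apply/eqP; congr `|_|; lra.
have := normr_ge0 (b - M a); nra.
Unshelve. all: by end_near.
Qed.

End sqrt_norm.

(** * Isometries fixing 0 and the choice of a sign *)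

Definition isometric (R : realType) (G : zmodType) (N : G -> R) (f : G -> G) :
  Prop := forall x y, N (f x - f y) = N (x - y).

(* If f x = - x and f y = y, the recentred isometry u |-> f (u + x) - f x sends
   y - x to y + x, which has to be y - x or x - y. *)
Lemma isometric_pm (G : zmodType) (R : realType) (N : G -> R) :
  (forall f, isometric N f -> f 0 = 0 -> forall x, f x = x \/ f x = - x) ->
  forall f, isometric N f -> f 0 = 0 ->
  (forall x, f x = x) \/ (forall x, f x = - x).
Proof.
move=> pm f fN f0; have [|/existsNP[x fx]] := pselect (forall x, f x = x).
  by left.
right=> y; apply: contrapT => fy.
have fxN : f x = - x by case: (pm f fN f0 x).
have fyy : f y = y by case: (pm f fN f0 y).
pose g u := f (u + x) - f x.
have gN : isometric N g.
  by move=> u v; rewrite /g opprB addrA subrK fN opprD addrACA subrr addr0.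
have g0 : g 0 = 0 by rewrite /g add0r subrr.
have := pm g gN g0 (y - x); rewrite /g subrK fxN fyy opprK opprB => -[e|e].
  by apply: fx; rewrite fxN; apply/esym/(addrI y).
by apply: fy; rewrite fyy; apply: (addIr x); rewrite e addrC.
Qed.

Lemma Iso_norm (G : zmodType) (R : realType) (N : G -> R) :
  group_norm N ->
  (forall f, isometric N f -> f 0 = 0 -> forall x, f x = x \/ f x = - x) ->
  Iso (fun x y : G => N (x - y)) = [set f | exists a : G, f = (fun x => a + x)]
              `|` [set f | exists a : G, f = (fun x => a - x)].
Proof.
move=> [_ _ NN _] pm; apply/seteqP; split=> f.
  move=> [_ fN]; pose g x := f x - f 0.
  have gN : isometric N g by move=> x y; rewrite /g opprB addrA subrK; exact: fN.
  have g0 : g 0 = 0 by rewrite /g subrr.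
  have fE x : f x = f 0 + g x by rewrite /g addrCA subrr addr0.
  case: (isometric_pm pm gN g0) => gE; [left|right];
    by exists (f 0); apply/funext => x; rewrite [LHS]fE gE.
move=> [[a ->]|[a ->]]; split=> [|x y].
- by exists (fun x => - a + x) => x; rewrite addrA ?subrr ?addNr add0r.
- by rewrite opprD addrACA subrr add0r.
- by exists (fun x => a - x) => x; rewrite opprB addrCA subrr addr0.
- by rewrite opprB addrC addrA subrK -NN opprB.
Qed.

(** A term [d n] within [r / 2] of [x] has its image within [r / 2] of [f x]; as this image is [d n]
    or [- d n], it puts [f x] within [r] of [x] or [- x]. *)
Lemma isometric_pm_dense (R : realType) (G : topologicalZmodType) (N : G -> R)
    (d : nat -> G) (f : G -> G) :
  group_norm N -> norm_topology N ->
  (forall (x : G) (A : set G), nbhs x A -> exists n, A (d n)) ->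
  isometric N f -> (forall n, f (d n) = d n \/ f (d n) = - d n) ->
  forall x, f x = x \/ f x = - x.
Proof.
move=> nN tN d_dense fN fd x; have [N0 Neq0 NN Ntri] := nN.
apply: contrapT => /not_orP[fx fNx].
have Npos u v : u <> v -> 0 < N (u - v).
  move=> uv; rewrite lt_neqAle N0 andbT eq_sym; apply/eqP => /Neq0/eqP.
  by rewrite subr_eq0 => /eqP.
have [r r0 [r1 r2]] : exists2 r : R, 0 < r & r <= N (f x - x) /\ r <= N (f x - - x).
  exists (Num.min (N (f x - x)) (N (f x - - x))).
    by rewrite lt_min !Npos.
  by rewrite !ge_min !lexx orbT.
have [n /= dn] : exists n, N (x - d n) < r / 2.
  apply: (d_dense x [set y | N (x - y) < r / 2]).
  by rewrite (norm_nbhs x nN tN); exists (r / 2) => //=; lra.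
case: (fd n) => fdn.
  have := Ntri (f x - f (d n)) (d n - x).
  by rewrite fN {1}fdn addrA subrK -[N (d n - x)]NN opprB; lra.
have := Ntri (f x - f (d n)) (- d n - - x).
by rewrite opprK in r2; rewrite fN {1}fdn addrA subrK opprK [- d n + x]addrC; lra.
Qed.

(** * Encoding a point up to sign by a real number *)

Section digits.
Context {R : realType} {G : zmodType} (d : nat -> G).

(** Counts the cones of index [n] with apex [x] in the perturbation below, one at [d n] and one at
    [- d n]; the value 2 occurs when [d n = - d n]. *)
Definition digit (x : G) (n : nat) : R := (x == d n)%:R + (x == - d n)%:R.

Definition digit_sum (x : G) : R := wsum (digit x).

Lemma digit_range x n : 0 <= digit x n <= 2.
Proof.
by rewrite /digit; do 2 case: (x == _); rewrite /=; apply/andP; split; lra.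
Qed.

Lemma digit_norm x n : `|digit x n| <= 2.
Proof. by have /andP[? ?] := digit_range x n; rewrite ger0_norm. Qed.

Lemma digit_sum_range x : 0 <= digit_sum x <= 2.
Proof.
apply/andP; split; last first.
  exact: le_trans (ler_norm _) (wsum_norm (digit_norm x)).
by apply: (@wsum_ge0 _ _ 2) => n; have /andP[] := digit_range x n.
Qed.

(** If [x] is not [d n] up to sign, take the least [m] at which either point has a nonzero digit.
    They do not both have one there, so the lexicographic comparison separates the sums. *)
Lemma digit_sum_inj x n : digit_sum x = digit_sum (d n) ->
  x = d n \/ x = - d n.
Proof.
pose P z m := (z == d m) || (z == - d m).
have digit0 z m : ~~ P z m -> digit z m = 0.
  by rewrite /digit /P negb_or => /andP[/negPf-> /negPf->]; rewrite addr0.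
have digit1 z m : P z m -> 1 <= digit z m.
  by rewrite /digit; move=> /orP[->|->]; rewrite ?lerDl ?lerDr.
set y := d n => e; apply: contrapT => /not_orP[xy xNy].
have excl m : P x m -> P y m -> False.
  move=> /orP[/eqP xm|/eqP xm] /orP[/eqP ym|/eqP ym].
  - by apply: xy; rewrite ym.
  - by apply: xNy; rewrite ym opprK.
  - by apply: xNy; rewrite ym.
  - by apply: xy; rewrite ym.
have [|m Pm Pmin] := @ex_minnP (fun m => P x m || P y m).
  by exists n; rewrite /P eqxx orbT.
have notP z i : (z = x \/ z = y) -> (i < m)%N -> ~~ P z i.
  move=> zxy im; apply/negP => Pz; have := Pmin i.
  by case: zxy => <-; rewrite Pz ?orbT => /(_ isT); rewrite leqNgt im.
have lt_digits u v : (u = x \/ u = y) -> P v m -> ~~ P u m ->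
    digit_sum u < digit_sum v.
  move=> uxy Pv Pu; apply: (@wsum_lt_digits _ m).
  - exact: digit_range.
  - exact: digit_range.
  - move=> i; rewrite leq_eqVlt => /orP[/eqP->|im]; apply: digit0 => //.
    exact: notP.
  - exact: digit1.
case/orP: (Pm) => Pz.
  have : digit_sum y < digit_sum x.
    by apply: lt_digits => //; [right|apply/negP => /(excl m Pz)].
  by rewrite e ltxx.
have : digit_sum x < digit_sum y.
  by apply: lt_digits => //; [left|apply/negP => /excl/(_ Pz)].
by rewrite e ltxx.
Qed.

End digits.

(** * The nondiscrete case: a norm with prescribed slopes *)

Lemma norm_equivalent (R : realType) (G : topologicalZmodType) (M N : G -> R) :
  norm_topology M -> norm_proper M ->
  (forall x, 3 / 4 * M x <= N x <= 5 / 4 * M x) ->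
  norm_topology N /\ norm_proper N.
Proof.
move=> tM pM MN; split.
  rewrite /norm_topology tM; apply/seteqP; split=> U [e /= e0 HU].
    exists (e / 2) => /=; first lra.
    by move=> x /= Nx; apply: HU => /=; have /andP[] := MN x; lra.
  exists (e / 2) => /=; first lra.
  by move=> x /= Mx; apply: HU => /=; have /andP[] := MN x; lra.
move=> r; have [K cK MK] := pM (2 * r); exists K => // x /= Nx; apply: MK => /=.
by have /andP[] := MN x; lra.
Qed.

(* Superposes on M cones with apexes at the points [d n] and [- d n], with
   slopes that determine [d n] up to sign. *)
Section spiked_norm.
Context {R : realType} {G : topologicalZmodType} (M : G -> R) (d : nat -> G).
Hypotheses (nM : group_norm M) (tM : norm_topology M) (pM : norm_proper M).
Hypothesis M_half : forall x y, M y <= M x -> M (x + y) <= M x + M y / 2.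
Hypothesis M_slope : forall a,
  (M (a + h) - M a) / M h @[h --> (0 : G)^'] --> ((a == 0)%:R : R).

(** The constant makes the cone vanish at 0, which bounds it by [2 * M x] uniformly in [n]. *)
Let cone x n := M (x - d n) + M (x + d n) - 2 * M (d n).

Definition spiked_norm x := M x + 8^-1 * wsum (cone x).

Let cone_lip x y n : `|cone (x + y) n - cone x n| <= 2 * M y.
Proof.
have eq_y z : x + y + z - (x + z) = y.
  by rewrite opprD addrACA subrr addr0 addrAC subrr add0r.
have h1 := norm_le_dist (x + y - d n) (x - d n) nM.
have h2 := norm_le_dist (x + y + d n) (x + d n) nM.
rewrite eq_y in h1; rewrite eq_y in h2.
move: h1 h2; rewrite /cone !ler_norml => /andP[? ?] /andP[? ?].
by apply/andP; split; lra.
Qed.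

Let cone0 n : cone 0 n = 0.
Proof. by have [_ _ MN _] := nM; rewrite /cone !add0r MN; lra. Qed.

Let cone_norm x n : `|cone x n| <= 2 * M x.
Proof. by have := cone_lip 0 x n; rewrite add0r cone0 subr0. Qed.

Let wsum_cone_lip x y :
  `|wsum (cone (x + y)) - wsum (cone x)| <= 2 * M y.
Proof.
have [M0 _ _ _] := nM.
rewrite -(@wsumB _ _ _ (2 * M (x + y) + 2 * M x)).
- by apply: wsum_norm => n; exact: cone_lip.
- by move=> n; have := M0 x; have := cone_norm (x + y) n; lra.
- by move=> n; have := M0 (x + y); have := cone_norm x n; lra.
Qed.

Let wsum_cone_norm x : `|wsum (cone x)| <= 2 * M x.
Proof. exact: wsum_norm (cone_norm x). Qed.

Lemma spiked_norm_equivalent x :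
  3 / 4 * M x <= spiked_norm x <= 5 / 4 * M x.
Proof.
have := wsum_cone_norm x; rewrite ler_norml /spiked_norm => /andP[? ?].
by apply/andP; split; lra.
Qed.

Lemma spiked_norm_group_norm : group_norm spiked_norm.
Proof.
have [M0 Meq0 MN Mtri] := nM; split=> [x|x|x|x y].
- by have := M0 x; have /andP[] := spiked_norm_equivalent x; lra.
- split=> [Nx|->].
    apply/Meq0/eqP; rewrite eq_le M0 andbT.
    by have /andP[] := spiked_norm_equivalent x; lra.
  have /andP[] := spiked_norm_equivalent 0; rewrite (Meq0 0).2// !mulr0 => ? ?.
  by apply/eqP; rewrite eq_le; apply/andP.
- rewrite /spiked_norm MN; congr (_ + _ * wsum _); apply/funext => n.
  rewrite /cone -opprD MN [- x + _]addrC -[d n - x]opprB MN.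
  by rewrite [M (x + _) + _]addrC.
- wlog yx : x y / M y <= M x.
    move=> wl; have [|/ltW xy] := leP (M y) (M x); first exact: wl.
    by rewrite [x + y]addrC [leRHS]addrC; exact: wl.
  (* The factor 1/8 is fitted here: moving from [x] to [x + y] changes the perturbation by at most
     [M y / 4], that of [y] is at least [- M y / 4], and [M_half] saves exactly [M y / 2]. *)
  have := M_half yx; have := wsum_cone_lip x y; have := wsum_cone_norm y.
  rewrite !ler_norml /spiked_norm => /andP[? ?] /andP[? ?] ?; lra.
Qed.

Let slope x : R := (x == 0)%:R + 8^-1 * digit_sum d x.

(** The difference quotients of the cones are bounded by 2, so the limit is taken cone by cone; by
    [M_slope] a cone contributes 1 at its apex and 0 elsewhere, which adds up to [digit_sum]. *)
Lemma spiked_norm_slope x :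
  (spiked_norm (x + h) - spiked_norm x) / M h @[h --> (0 : G)^'] --> slope x.
Proof.
have [M0 Meq0 MN Mtri] := nM.
have Mh_le h n : `|(cone (x + h) n - cone x n) / M h| <= 2.
  (* [wsum_dominated] asks for the bound at every [h]; at [h = 0] the quotient is 0 by
     convention. *)
  have [->|h0] := eqVneq h 0; first by rewrite (Meq0 0).2// invr0 mulr0 normr0.
  have Mh : 0 < M h.
    by rewrite lt_neqAle M0 andbT eq_sym; apply: contra_neq h0 => /Meq0.
  rewrite normrM [`|(M h)^-1|]gtr0_norm ?invr_gt0// ler_pdivrMr//.
have -> : (fun h => (spiked_norm (x + h) - spiked_norm x) / M h) =
    (fun h => (M (x + h) - M x) / M h +
       8^-1 * wsum (fun n => (cone (x + h) n - cone x n) / M h)).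
  apply/funext => h.
  have -> : (fun n => (cone (x + h) n - cone x n) / M h) =
      (fun n => (M h)^-1 * (cone (x + h) n - cone x n)).
    by apply/funext => n; rewrite mulrC.
  rewrite (@wsumZ _ _ _ (2 * M h)) => [|n]; last exact: cone_lip.
  rewrite (@wsumB _ _ _ (2 * M (x + h) + 2 * M x)) /spiked_norm; first lra.
    by move=> n; have := M0 x; have := cone_norm (x + h) n; lra.
  by move=> n; have := M0 (x + h); have := cone_norm x n; lra.
apply: cvgD; first exact: M_slope.
apply: cvgMr; apply: (@wsum_dominated _ _ _ _ _ _ 2) => //.
  exact: digit_norm.
move=> n.
have -> : (fun h => (cone (x + h) n - cone x n) / M h) =
    (fun h => (M ((x - d n) + h) - M (x - d n)) / M h +
              (M ((x + d n) + h) - M (x + d n)) / M h).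
  by apply/funext => h; rewrite /cone ![x + _ + h]addrAC; lra.
rewrite /digit -subr_eq0 -[in (x == - d n)]subr_eq0 opprK.
by apply: cvgD; exact: M_slope.
Qed.

Hypothesis nondiscrete : ~ nbhs 0 [set (0 : G)].

Lemma spiked_norm_isometric (f : G -> G) : isometric spiked_norm f ->
  f 0 = 0 -> forall n, f (d n) = d n \/ f (d n) = - d n.
Proof.
move=> fN f0 n; set N := spiked_norm in fN *.
have nN : group_norm N := spiked_norm_group_norm.
have [tN _] := norm_equivalent tM pM spiked_norm_equivalent.
have [N0 Neq0 NN Ntri] := nN.
(* Limits along the punctured neighbourhoods are unique because 0 is not isolated. *)
have FF : ProperFilter (0 : G)^'.
  apply: Build_ProperFilter => nbhs0; apply: nondiscrete.
  have : nbhs 0 [set x : G | x != 0 -> False] by [].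
  by apply: filterS => x /= x0; apply: contrapT => /eqP /x0.
(* The increment of [f] at [x] has the same norm as [h], so it tends to 0 without reaching it. *)
pose k x h := f (x + h) - f x.
have kN x h : N (k x h) = N h by rewrite /k fN addrAC subrr add0r.
have k_cvg x : k x h @[h --> (0 : G)^'] --> (0 : G)^'.
  move=> U U0; have : nbhs (0 : G) [set y | y != 0 -> U y] := U0.
  rewrite [in X in X -> _]tN => -[e /= e0 eU].
  suff : nbhs (0 : G) [set h | h != 0 -> U (k x h)] by [].
  rewrite tN; exists e => // h /= Nh h0; apply: eU; first by rewrite /= -/N kN.
  by apply: contra_neq h0 => kx0; apply/Neq0; rewrite -(kN x) kx0; apply/Neq0.
have slope_gt0 : 0 < slope 0.
  have /andP[? _] := @digit_sum_range R _ d 0; rewrite /slope eqxx /=; lra.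
(* the slope of N at x measured against N itself is preserved by f *)
have cvg_ratio x : (N (x + h) - N x) / N h @[h --> (0 : G)^'] -->
    slope x / slope 0.
  have N_M : N h / M h @[h --> (0 : G)^'] --> slope 0.
    have := @spiked_norm_slope 0; rewrite -/N (Neq0 0).2//.
    by under eq_fun do rewrite add0r subr0.
  have L : (N (x + h) - N x) / M h * (N h / M h)^-1 @[h --> (0 : G)^'] -->
      slope x / slope 0.
    apply: cvgM; first exact: spiked_norm_slope.
    by apply: cvgV => //; exact: lt0r_neq0.
  apply: (cvg_trans _ L); apply: near_eq_cvg; near=> h.
  have h0 : h != 0 by near: h; exact: nbhs_dnbhs_neq.
  have [M0 Meq0 _ _] := nM.
  have Mh : M h != 0 by apply: contra_neq h0 => /Meq0.
  by rewrite /= invf_div mulrA divfK.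
(* Substituting [k x h] for [h] in the ratio at [f x] gives the ratio at [x], as [N (f y) = N y]. *)
have slope_f x : slope (f x) = slope x.
  apply: (divIf (lt0r_neq0 slope_gt0)).
  have L : (N (f x + k x h) - N (f x)) / N (k x h) @[h --> (0 : G)^'] -->
      slope (f x) / slope 0.
    exact: cvg_comp (k_cvg x) (cvg_ratio (f x)).
  have Nf y : N (f y) = N y by rewrite -[f y]subr0 -{1}f0 fN subr0.
  rewrite -(cvg_lim (@Rhausdorff R) (cvg_ratio x)); apply/esym/cvg_lim => //.
  apply: (cvg_trans _ L); apply: near_eq_cvg; near=> h.
  by rewrite /= kN /k [f x + _]addrCA subrr addr0 !Nf.
have [dn0|dn0] := eqVneq (d n) 0; first by left; rewrite dn0.
have fdn0 : f (d n) != 0.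
  apply: contra_neq dn0 => fdn0; apply/Neq0; rewrite -[d n]subr0 -fN f0 fdn0 subr0.
  exact/Neq0.
apply: (@digit_sum_inj R).
have := slope_f (d n); rewrite /slope (negPf dn0) (negPf fdn0); lra.
Unshelve. all: by end_near.
Qed.

End spiked_norm.

(** * The discrete case: a norm injective up to sign *)

Section discrete_norm.
Context {R : realType} {G : topologicalZmodType} (M : G -> R) (d : nat -> G).
Hypotheses (nM : group_norm M) (pM : norm_proper M).
Hypothesis discrete : nbhs 0 [set (0 : G)].

Let frac x : R := if x == 0 then 0 else 4^-1 + 16^-1 * digit_sum d x.

(* The values of [frac] off 0 lie in [1/4, 3/8]: hence [frac] is subadditive,
   and it is the fractional part of the norm. *)
Definition discrete_norm x : R := (Num.ceil (M x))%:~R + frac x.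

Let frac_range x : x != 0 -> 4^-1 <= frac x <= 3 / 8.
Proof.
move=> /negPf x0; rewrite /frac x0.
by have /andP[? ?] := @digit_sum_range R _ d x; apply/andP; split; lra.
Qed.

Let frac_ge0 x : 0 <= frac x.
Proof.
have [->|/frac_range/andP[+ _]] := eqVneq x 0; first by rewrite /frac eqxx.
by apply: le_trans; rewrite invr_ge0.
Qed.

Let fracN x : frac (- x) = frac x.
Proof.
rewrite /frac oppr_eq0; case: eqP => // _; congr (_ + _ * wsum _).
apply/funext => n; rewrite /digit addrC eqr_opp; congr ((_ == _)%:R + _%:R).
by rewrite eqr_oppLR.
Qed.

Let le_discrete_norm x : M x <= discrete_norm x.
Proof. by rewrite (le_trans (ceil_ge _))// lerDl. Qed.

Let discrete_norm_ge x : x != 0 -> 4^-1 <= discrete_norm x.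
Proof.
have [M0 _ _ _] := nM => /frac_range/andP[fx _].
apply: le_trans fx _; rewrite lerDr.
by apply: le_trans (M0 x) _; exact: ceil_ge.
Qed.

Let discrete_norm0 : discrete_norm 0 = 0.
Proof.
have [_ Meq0 _ _] := nM.
by rewrite /discrete_norm (Meq0 0).2// ceil0 /frac eqxx addr0.
Qed.

Lemma discrete_norm_group_norm : group_norm discrete_norm.
Proof.
have [M0 Meq0 MN Mtri] := nM; split=> [x|x|x|x y].
- exact: le_trans (le_discrete_norm x).
- split=> [Nx|->]; last exact: discrete_norm0.
  apply/Meq0/eqP; rewrite eq_le M0 andbT -Nx; exact: le_discrete_norm.
- by rewrite /discrete_norm MN fracN.
- have [->|x0] := eqVneq x 0; first by rewrite discrete_norm0 !add0r.
  have [->|y0] := eqVneq y 0; first by rewrite discrete_norm0 !addr0.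
  have : ((Num.ceil (M (x + y)))%:~R : R) <= (Num.ceil (M x) + Num.ceil (M y))%:~R.
    rewrite ler_int ceil_le_int; apply: le_trans (Mtri x y) _.
    by rewrite intrD lerD// ceil_ge.
  have : frac (x + y) <= 3 / 8.
    have [->|] := eqVneq (x + y) 0; first by rewrite /frac eqxx; lra.
    by move=> /frac_range/andP[].
  have /andP[] := frac_range x0; have /andP[] := frac_range y0.
  rewrite intrD /discrete_norm; lra.
Qed.

Lemma discrete_norm_topology : norm_topology discrete_norm.
Proof.
apply/seteqP; split=> U.
  move=> U0; exists 4^-1 => [|x /= Nx]; first by rewrite /= invr_gt0.
  have -> : x = 0.
    apply/eqP; apply: contraTT Nx => /discrete_norm_ge; by rewrite leNgt.
  exact: nbhs_singleton.
move=> [e /= e0 eU]; apply: filterS discrete => x /= ->; apply: eU.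
by rewrite /= discrete_norm0.
Qed.

Lemma discrete_norm_proper : norm_proper discrete_norm.
Proof.
move=> r; have [K cK MK] := pM r; exists K => // x /= Nx; apply: MK => /=.
exact: le_trans (le_discrete_norm x) Nx.
Qed.

Hypothesis d_dense : forall (x : G) (A : set G), nbhs x A -> exists n, A (d n).

(** Discreteness makes every [y] a term of [d]. Fractional parts of nonzero points differ by at most
    1/8, so equal norms force equal ceilings, hence equal digit sums. *)
Lemma discrete_norm_inj x y : discrete_norm x = discrete_norm y ->
  x = y \/ x = - y.
Proof.
have [n ->] : exists n, y = d n.
  have : nbhs y [set y].
    by apply/nbhs_addl; apply: filterS discrete => h /= ->; rewrite addr0.
  by move=> /d_dense[n /= <-]; exists n.
have [_ Neq0 _ _] := discrete_norm_group_norm.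
have [->|y0] := eqVneq (d n) 0.
  by rewrite discrete_norm0 => /Neq0; left.
have [->|x0] := eqVneq x 0.
  by rewrite discrete_norm0 => /esym/Neq0 dn0; rewrite dn0 eqxx in y0.
rewrite /discrete_norm => e.
have /andP[? ?] := frac_range x0; have /andP[? ?] := frac_range y0.
have ceq : Num.ceil (M x) = Num.ceil (M (d n)).
  apply/eqP; rewrite eq_le -!ltzD1 -!(ltr_int R) !intrD.
  by apply/andP; split; lra.
move: e; rewrite ceq => /addrI; rewrite /frac (negPf x0) (negPf y0) => e.
by apply: (@digit_sum_inj R); lra.
Qed.

End discrete_norm.
Unset Implicit Arguments.

Theorem proposition1p4 (R : realType) (G : topologicalZmodType)
    (hlc : locally_compact [set: G]) (hpolish : polish R G) :
  exists rho : G -> G -> R,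
    [/\ Metr_c R G rho, invariant_metric rho
      & Iso rho = [set f | exists a : G, f = (fun x => a + x)]
              `|` [set f | exists a : G, f = (fun x => a - x)]].
Proof.
have [d d_dense] := @separable_seq G 0 hpolish.1.
have [N [nN tN pN]] := proper_norm_exists hlc hpolish.
have [discrete|nondiscrete] := pselect (nbhs 0 [set (0 : G)]).
  have nL := discrete_norm_group_norm d nN.
  have tL := discrete_norm_topology d nN discrete.
  exists (fun x y => discrete_norm N d (x - y)); split.
  - exact: norm_Metr_c nL tL (discrete_norm_proper d pN).
  - exact: norm_invariant.
  - apply: (Iso_norm nL) => f fN f0 x.
    apply: (discrete_norm_inj nN discrete d_dense).
    by have := fN x 0; rewrite f0 !subr0.
have nM := sqrt_norm_group_norm nN; have tM := sqrt_norm_topology nN tN.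
have pM := sqrt_norm_proper nN pN; have half := sqrt_norm_half nN.
have slope := sqrt_norm_slope nN tN.
have nL := spiked_norm_group_norm d nM half.
have [tL pL] := norm_equivalent tM pM (spiked_norm_equivalent d nM).
exists (fun x y => spiked_norm (fun x => Num.sqrt (N x)) d (x - y)); split.
- exact: norm_Metr_c nL tL pL.
- exact: norm_invariant.
- apply: (Iso_norm nL) => f fN f0.
  apply: (isometric_pm_dense nL tL d_dense fN).
  exact: (spiked_norm_isometric nM tM pM half slope nondiscrete fN f0).
Qed.
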